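(* Let $M$ be an oriented one-cusped hyperbolic 3-manifold with an ideal triangulation $\mathcal T$, let $\alpha:\pi_1(M)\to\mathbb Z$ be an epimorphism and $\mu$ a peripheral curve with $\alpha(\mu)=1$. Then the twisted Neumann--Zagier matrices $\mathbf A(t),\mathbf B(t)$ of $\mathcal T$ satisfy $$\mathbf A(t)\,\mathbf B(1/t)^T=\mathbf B(t)\,\mathbf A(1/t)^T .$$
   Context: $M$ is an oriented (complete, finite volume) hyperbolic 3-manifold with one torus cusp. An ideal triangulation $\mathcal T$ of $M$ with $N$ tetrahedra $\Delta_1,\dots,\Delta_N$ has exactly $N$ edges $e_1,\dots,e_N$. A quad type of a tetrahedron is a pair of opposite edges. Fixing a quad type of each oriented tetrahedron $\Delta_j$, the pairs of opposite edges of $\Delta_j$ are labelled by $z_j,z_j',z_j''$ (the chosen quad type gets $z_j$; seen from each ideal vertex the labels occur in the counterclockwise cyclic order $z_j,z'_j,z''_j$). The symbol $\square$ stands for no prime, one prime or two primes. A peripheral curve is an oriented homotopically non-trivial simple closed curve in the peripheral torus of $M$. $\widetilde M$ is the cover of $M$ corresponding to $\alpha^{-1}(0)$, with lifted ideal triangulation $\widetilde{\mathcal T}$; its deck group $\mathbb Z$ is generated by the action of $\mu$. Choose lifts $\widetilde e_i,\widetilde\Delta_j$ of $e_i,\Delta_j$ to $\widetilde{\mathcal T}$. For $k\in\mathbb Z$, $\mathbf G_k^\square$ is the $N\times N$ integer matrix whose $(i,j)$-entry is the number of edges of $\mu^k\cdot\widetilde\Delta_j$ labelled $z_j^\square$ that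 are incident (identified) to $\widetilde e_i$ in $\widetilde{\mathcal T}$ (zero for all but finitely many $k$). The twisted gluing equation matrices are $\mathbf G^\square(t)=\sum_{k\in\mathbb Z}\mathbf G_k^\square t^k$ and the twisted Neumann--Zagier matrices are $\mathbf A(t)=\mathbf G(t)-\mathbf G'(t)$, $\mathbf B(t)=\mathbf G''(t)-\mathbf G'(t)$, with entries in $\mathbb Z[t^{\pm1}]$. *)

(* Defs.v *)
From HB Require Import structures.
From Stdlib Require Import Relation_Operators.
From mathcomp Require Import all_boot all_order all_algebra.
From mathcomp Require Import fingroup perm fraction.
From mathcomp Require Import all_classical all_reals all_analysis.

Set Implicit Arguments.
Unset Strict Implicit.
Unset Printing Implicit Defensive.

Import Order.TTheory GRing.Theory Num.Theory.
Import numFieldNormedType.Exports.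

Local Open Scope classical_set_scope.
Local Open Scope ring_scope.

(* The upper half-space model; a point is ((x, y), h) with height h > 0. *)
Definition H3 (R : realType) : set (R * R * R) := [set p | 0 < p.2].
Arguments H3 : clear implicits.

Definition hyp_dist (R : realType) (p q : H3 R) : R :=
  let: (x, y, h) := set_val p in
  let: (x', y', h') := set_val q in
  let u := 1 + ((x - x') ^+ 2 + (y - y') ^+ 2 + (h - h') ^+ 2)
                 / (2 * h * h') in
  (* arcosh u *)
  ln (u + Num.sqrt (u ^+ 2 - 1)).

Definition hyp_volume (R : realType)
    (F : set (measurableTypeR R * measurableTypeR R * measurableTypeR R)) :
    \bar R :=
  (\int[(@lebesgue_measure R \x @lebesgue_measure R) \x @lebesgue_measure R]_(p
     in F) ((p.2 : R) ^- 3)%:E)%E.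

(* A complete hyperbolic 3-manifold of finite volume is a quotient of H3 by a
   group Gamma of isometries acting freely and properly discontinuously, with
   finite covolume; q is the quotient map. *)
Record hyperbolic_quotient (R : realType) (M : topologicalType)
    (Gamma : set (H3 R -> H3 R)) (q : H3 R -> M) : Prop := {
  Gamma_id : Gamma id;
  Gamma_comp : forall g h, Gamma g -> Gamma h -> Gamma (g \o h);
  Gamma_inv : forall g, Gamma g ->
    exists h, [/\ Gamma h, cancel g h & cancel h g];
  Gamma_isometry : forall g, Gamma g ->
    forall x y, hyp_dist (g x) (g y) = hyp_dist x y;
  Gamma_free : forall g x, Gamma g -> g x = x -> g = id;
  Gamma_properly_discontinuous : forall K : set (H3 R), compact K ->
    finite_set [set g | Gamma g /\ (g @` K) `&` K !=set0];
  q_continuous : continuous q;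
  q_open : forall U : set (H3 R), open U -> open (q @` U);
  q_surj : forall m : M, exists x, q x = m;
  q_orbit : forall x y, q x = q y <-> exists2 g, Gamma g & y = g x;
  finite_covolume : exists F,
    [/\ measurable F, F `<=` H3 R,
        forall m : M, exists2 x, F (set_val x) & q x = m
      & (hyp_volume F < +oo)%E] }.

Definition hyperbolic_3manifold (R : realType) (M : topologicalType) : Prop :=
  exists (Gamma : set (H3 R -> H3 R)) (q : H3 R -> M),
    hyperbolic_quotient Gamma q.

(* M has exactly one end, and c parametrizes a closed neighbourhood of it by a
   torus times a half-line, the torus being the quotient of the horizontal
   planes of H3 by the integer translations. *)
Record torus_cusp (R : realType) (M : topologicalType) (c : H3 R -> M) :
    Prop := {
  cusp_continuous : continuous c;
  cusp_open : forall U : set (H3 R), open U -> open (c @` U);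
  cusp_lattice : forall p q, c p = c q <->
    exists m n : int, set_val q =
      ((set_val p).1.1 + m%:~R, (set_val p).1.2 + n%:~R, (set_val p).2);
  cusp_closed : closed (c @` [set p | 1 <= (set_val p).2]);
  cusp_cocompact : compact (~` (c @` [set p | 1 < (set_val p).2])) }.

Definition peripheral_torus (R : realType) (M : topologicalType)
    (c : H3 R -> M) : set M := c @` [set p | (set_val p).2 = 1].

(* Paths are functions on R of which only the restriction to [0, 1] matters. *)
Record path_in (R : realType) (M : topologicalType) (A : set M) (f : R -> M)
    (x y : M) : Prop := {
  path_continuous : {within `[0, 1], continuous f};
  path_source : f 0 = x;
  path_target : f 1 = y;
  path_sub : forall s, 0 <= s <= 1 -> A (f s) }.

Definition loop_at (R : realType) (M : topologicalType) (x : M) (f : R -> M) :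
  Prop := path_in setT f x x.

(* Homotopy inside A relative to the endpoints. *)
Definition path_homotopic (R : realType) (M : topologicalType) (A : set M)
    (f g : R -> M) : Prop :=
  exists H : R * R -> M,
    [/\ {within `[0, 1] `*` `[0, 1], continuous H},
        forall s u, 0 <= s <= 1 -> 0 <= u <= 1 -> A (H (s, u)),
        forall s, 0 <= s <= 1 -> H (s, 0) = f s /\ H (s, 1) = g s
      & forall u, 0 <= u <= 1 -> H (0, u) = f 0 /\ H (1, u) = f 1].

Definition path_concat (R : realType) (M : Type) (f g : R -> M) : R -> M :=
  fun s => if s <= 2^-1 then f (2 * s) else g (2 * s - 1).

(* An epimorphism from the fundamental group of M at x onto the integers,
   given on representing loops; its values on non-loops are irrelevant. *)
Record pi1_epimorphism (R : realType) (M : topologicalType) (x : M)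
    (alpha : (R -> M) -> int) : Prop := {
  alpha_homotopy : forall f g, loop_at x f -> loop_at x g ->
    path_homotopic setT f g -> alpha f = alpha g;
  alpha_concat : forall f g, loop_at x f -> loop_at x g ->
    alpha (path_concat f g) = alpha f + alpha g;
  alpha_surj : forall n, exists2 f, loop_at x f & alpha f = n }.

Record peripheral_curve (R : realType) (M : topologicalType) (c : H3 R -> M)
    (mu : R -> M) : Prop := {
  curve_closed : path_in (peripheral_torus c) mu (mu 0) (mu 0);
  curve_simple : forall s u, 0 <= s < 1 -> 0 <= u < 1 -> mu s = mu u -> s = u;
  curve_nontrivial : ~ path_homotopic (peripheral_torus c) mu (fun=> mu 0) }.

Definition path_connected_space (R : realType) (M : topologicalType) : Prop :=
  forall x y : M, exists f : R -> M, path_in setT f x y.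

Definition evenly_covered (Mt M : topologicalType) (p : Mt -> M) (U : set M) :
    Prop :=
  exists S : set (set Mt),
    [/\ forall V, S V -> open V,
        forall V W, S V -> S W -> V `&` W !=set0 -> V = W,
        p @^-1` U = \bigcup_(V in S) V,
        forall V, S V ->
          p @` V = U /\ (forall x y, V x -> V y -> p x = p y -> x = y)
      & forall V W, S V -> open W -> W `<=` V -> open (p @` W)].

Record covering_map (Mt M : topologicalType) (p : Mt -> M) : Prop := {
  covering_continuous : continuous p;
  covering_surj : forall m, exists x, p x = m;
  covering_local : forall m, exists U,
    [/\ open U, U m & evenly_covered p U] }.

(* The connected cover whose fundamental group has image the kernel of
   alpha. *)
Record kernel_cover (R : realType) (M Mt : topologicalType)
    (alpha : (R -> M) -> int) (p : Mt -> M) (xt : Mt) : Prop := {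
  kernel_covering : covering_map p;
  kernel_connected : path_connected_space R Mt;
  kernel_image : forall f, loop_at (p xt) f ->
    (alpha f = 0 <->
     exists2 g, loop_at xt g & path_homotopic setT f (p \o g)) }.

Definition ziter (T : Type) (f finv : T -> T) (k : int) : T -> T :=
  match k with
  | Posz n => iter n f
  | Negz n => iter n.+1 finv
  end.

(* tau is the deck transformation by which the loop mu acts: it moves the base
   point xt to the end of the lift of mu starting at xt. The fibres of p are
   free orbits of tau, i.e. the cover is regular and its deck group is
   infinite cyclic, generated by tau. *)
Record deck_generator (R : realType) (M Mt : topologicalType) (p : Mt -> M)
    (xt : Mt) (mu : R -> M) (tau tauinv : Mt -> Mt) : Prop := {
  deck_continuous : continuous tau;
  deck_inv_continuous : continuous tauinv;
  deck_K : cancel tau tauinv;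
  deck_inv_K : cancel tauinv tau;
  deck_over : forall x, p (tau x) = p x;
  deck_lift : exists2 g, path_in setT g xt (tau xt)
                       & forall s, 0 <= s <= 1 -> p (g s) = mu s;
  deck_fibre : forall x y, p x = p y -> exists k, y = ziter tau tauinv k x;
  deck_free : forall x k, ziter tau tauinv k x = x -> k = 0 }.

(* Gluing data of an oriented triangulation with set of tetrahedra T. The face
   of t opposite to the vertex f is glued to the face of nbr t f opposite to
   glue t f f, by the map sending each vertex v <> f to glue t f v. The
   vertices are numbered so that, seen from vertex 0, the vertices 1, 2, 3
   occur in counterclockwise order; the orientations of two adjacent
   tetrahedra then match exactly when the gluing permutation is odd. A manifold
   triangulated by such data is oriented by its tetrahedra. *)
Record triangulation (T : Type) := Triangulation {
  nbr : T -> 'I_4 -> T;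
  glue : T -> 'I_4 -> 'S_4;
  nbrK : forall t f, nbr (nbr t f) (glue t f f) = t;
  glueK : forall t f, glue (nbr t f) (glue t f f) = ((glue t f)^-1)%g;
  glue_odd : forall t f, odd_perm (glue t f);
  glue_free : forall t f, (nbr t f, glue t f f) <> (t, f) }.

(* The tetrahedron without its vertices, in barycentric coordinates. *)
Definition ideal_simplex (R : realType) : set 'rV[R]_4 :=
  [set x | [/\ forall i, 0 <= x 0 i, \sum_i x 0 i = 1
             & forall i, x 0 i < 1]].
Arguments ideal_simplex : clear implicits.

Definition glue_step (R : realType) (T : Type) (D : triangulation T)
    (u v : T * ideal_simplex R) : Prop :=
  exists f : 'I_4,
    [/\ set_val u.2 0 f = 0, v.1 = nbr D u.1 f
      & forall i, set_val v.2 0 (glue D u.1 f i) = set_val u.2 0 i].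

(* The characteristic maps Phi t exhibit M as the topological quotient of the
   disjoint union of the ideal tetrahedra by the face gluings. *)
Record ideal_triangulation (R : realType) (T : Type) (D : triangulation T)
    (M : topologicalType) (Phi : T -> ideal_simplex R -> M) : Prop := {
  Phi_surj : forall m, exists t x, Phi t x = m;
  Phi_glue : forall t x t' x',
    Phi t x = Phi t' x' <->
    clos_refl_sym_trans _ (@glue_step R T D) (t, x) (t', x');
  Phi_quotient : forall U : set M,
    open U <-> forall t, open (Phi t @^-1` U) }.

(* An edge of a tetrahedron is the pair of its end vertices, and an edge of a
   triangulation is a class of edges of tetrahedra identified by the
   gluings. *)
Definition edge_step (T : Type) (D : triangulation T)
    (u v : T * {set 'I_4}) : Prop :=
  exists f : 'I_4,
    [/\ f \notin u.2, v.1 = nbr D u.1 f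
      & v.2 = (glue D u.1 f @: u.2)%SET].

Definition is_edge (T : Type) (D : triangulation T)
    (E : set (T * {set 'I_4})) : Prop :=
  exists (t : T) (a : {set 'I_4}),
    #|a| = 2%N /\ E = [set u | clos_refl_sym_trans _ (edge_step D) (t, a) u].

Record edge_enumeration (T I : Type) (D : triangulation T)
    (e : I -> set (T * {set 'I_4})) : Prop := {
  edge_is_edge : forall i, is_edge D (e i);
  edge_inj : injective e;
  edge_all : forall E, is_edge D E -> exists i, e i = E }.

(* Dt is the lift of D to the cover: proj sends a tetrahedron of Dt, with its
   vertex numbering, to the tetrahedron of D that it covers. *)
Record lifted_triangulation (R : realType) (T Tt : Type)
    (D : triangulation T) (Dt : triangulation Tt) (M Mt : topologicalType)
    (Phi : T -> ideal_simplex R -> M) (Phit : Tt -> ideal_simplex R -> Mt)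
    (p : Mt -> M) (proj : Tt -> T) : Prop := {
  lift_realized : ideal_triangulation Dt Phit;
  lift_Phi : forall t x, p (Phit t x) = Phi (proj t) x;
  lift_nbr : forall t f, proj (nbr Dt t f) = nbr D (proj t) f;
  lift_glue : forall t f, glue Dt t f = glue D (proj t) f }.

Definition is_quad_type (Q : {set {set 'I_4}}) : Prop :=
  exists a : {set 'I_4}, #|a| = 2%N /\ Q = [set a; ~: a]%SET.

(* m = 0, 1, 2 stands for z, z', z''. For an even permutation s, the vertices
   s 1, s 2, s 3 occur in counterclockwise order seen from s 0; if the edge
   s 0 s 1 belongs to the quad type Q, the edges from s 0 to s 1, s 2, s 3 are
   thus labelled z, z', z''. *)
Definition labelled (Q : {set {set 'I_4}}) (m : 'I_3) (a : {set 'I_4}) :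
    bool :=
  [exists s : 'S_4,
     [&& ~~ odd_perm s,
         [set s ord0; s (lift ord0 ord0)]%SET \in Q
       & a == [set s ord0; s (lift ord0 m)]%SET]].

Section TwistedNeumannZagier.
Variables (N : nat) (Tt : Type).
Variable Q : 'I_N -> {set {set 'I_4}}.
(* the action of the powers of mu on the tetrahedra of the cover *)
Variable act : int -> Tt -> Tt.
(* the chosen lifts of the edges and of the tetrahedra *)
Variable et : 'I_N -> set (Tt * {set 'I_4}).
Variable Deltat : 'I_N -> Tt.

Definition gluing_matrix (m : 'I_3) (k : int) : 'M[int]_N :=
  \matrix_(i, j)
    (#|[set a | labelled (Q j) m a && `[< et i (act k (Deltat j), a) >]]%SET|
      : int).

(* Laurent polynomials in t are evaluated at a unit x of a field: x = t is the
   indeterminate of Q(t), which contains Z[t, 1/t], and x = 1/t gives the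
   substitution of 1/t for t. *)
Definition twisted_gluing (K : fieldType) (m : 'I_3) (x : K) : 'M[K]_N :=
  \matrix_(i, j) \sum_(k \in [set: int]) (gluing_matrix m k i j)%:~R * x ^ k.

Definition NZ_A (K : fieldType) (x : K) : 'M[K]_N :=
  twisted_gluing (inord 0%N) x - twisted_gluing (inord 1%N) x.

Definition NZ_B (K : fieldType) (x : K) : 'M[K]_N :=
  twisted_gluing (inord 2%N) x - twisted_gluing (inord 1%N) x.

End TwistedNeumannZagier.

Definition indet : {fraction {poly int}} := tofrac 'X.

(* Main.v *)
Require Import Defs.
From Stdlib Require Import Relation_Operators.
From mathcomp Require Import all_boot all_order all_algebra.
From mathcomp Require Import fingroup perm fraction ring.
From mathcomp Require Import all_classical all_reals all_analysis.
Import Order.TTheory GRing.Theory Num.Theory.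
Import numFieldNormedType.Exports.
Local Open Scope ring_scope.

(** Write w(j, a) for the sum of the powers x^k such that the edge a of the
    translate mu^k Delta_j lies on a given edge of the cover, and v(j, a) for
    the same sum with another edge of the cover and 1/x in place of x. The
    contribution of Delta_j to an entry of A(x) B(1/x)^T - B(x) A(1/x)^T is,
    up to a global sign, the sum over the permutations u of the four vertices
    of sign(u) w(j, u0 u1) v(j, u0 u2), independently of the quad type. The
    edges u0 u1 and u0 u2 span the face opposite to u3. Crossing this face
    multiplies w and v by inverse powers of x, and changes the sign because the
    gluing permutation is odd; so the terms on the two sides of a face cancel.

    The powers of x are controlled by barycenters: two edges of tetrahedra
    belong to the same edge of the cover exactly when their midpoints have the
    same image, and the deck group acts freely on points. The barycenter of a
    tetrahedron determines it in the same way. *)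

Set Implicit Arguments.
Unset Strict Implicit.

(** * Sums over the permutations of four vertices *)

Lemma lift_perm0_bij n :
  bijective (fun p : 'I_n.+1 * 'S_n => lift_perm ord0 p.1 p.2).
Proof.
apply: inj_card_bij; last by rewrite card_prod !card_Sn card_ord factS.
move=> [i u] [j v] /= eq_uv.
have eq_ij : i = j by rewrite -(lift_perm_id ord0 i u) eq_uv lift_perm_id.
congr pair => //; apply/permP => k; apply: (@lift_inj _ i).
by rewrite -(lift_perm_lift ord0) eq_uv lift_perm_lift eq_ij.
Qed.

Lemma big_lift_perm0 (V : nmodType) n (F : 'S_n.+1 -> V) :
  \sum_u F u = \sum_(i < n.+1) \sum_(v : 'S_n) F (lift_perm ord0 i v).
Proof.
rewrite pair_big /=.
rewrite (reindex (fun p : 'I_n.+1 * 'S_n => lift_perm ord0 p.1 p.2)) //.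
exact/onW_bij/lift_perm0_bij.
Qed.

Lemma sum_S0 (V : nmodType) (F : 'S_0 -> V) : \sum_u F u = F 1%g.
Proof.
by rewrite (big_pred1 1%g) // => u; apply/esym/eqP/permP => -[].
Qed.

Local Notation o0 := (ord0 : 'I_4).
Local Notation o1 := (lift ord0 ord0 : 'I_4).
Local Notation o2 := (lift ord0 (lift ord0 ord0) : 'I_4).
Local Notation o3 := (lift ord0 (lift ord0 (lift ord0 ord0)) : 'I_4).

(** Gives the 24 terms a form in which signs and values compute by rewriting. *)
Lemma sum_S4 (V : nmodType) (F : 'S_4 -> V) :
  \sum_u F u = \sum_(i < 4) \sum_(j < 3) \sum_(k < 2)
    F (lift_perm ord0 i (lift_perm ord0 j (lift_perm ord0 k 1%g))).
Proof.
rewrite big_lift_perm0; apply: eq_bigr => i _.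
rewrite big_lift_perm0; apply: eq_bigr => j _.
rewrite big_lift_perm0; apply: eq_bigr => k _.
rewrite big_lift_perm0 big_ord1 sum_S0.
by rewrite lift_perm1.
Qed.

(** The terms in [g1 W * g1 V] cancel, leaving six signed products of sums over distinct pairs of
    opposite edges. Edges from distinct pairs share exactly one vertex, which is [u o0]; so the 24
    monomials correspond to the 24 permutations. *)
Lemma alternating_sum_S4 (K : comRingType) (W V : 'I_4 -> 'I_4 -> K) :
  (forall x y, W x y = W y x) -> (forall x y, V x y = V y x) ->
  let g0 (U : 'I_4 -> 'I_4 -> K) := U o0 o1 + U o2 o3 in
  let g1 (U : 'I_4 -> 'I_4 -> K) := U o0 o2 + U o1 o3 in
  let g2 (U : 'I_4 -> 'I_4 -> K) := U o0 o3 + U o1 o2 in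
  (g0 W - g1 W) * (g2 V - g1 V) - (g2 W - g1 W) * (g0 V - g1 V) =
  - \sum_(u : 'S_4) (-1) ^+ odd_perm u * (W (u o0) (u o1) * V (u o0) (u o2)).
Proof.
move=> WC VC g0 g1 g2; rewrite {}/g0 {}/g1 {}/g2.
(* Indexing by [nat] makes equal entries syntactically equal atoms for [ring], once symmetry has put
   their indices in increasing order. *)
pose W' x y := W (inord x) (inord y); pose V' x y := V (inord x) (inord y).
have WE x y : W x y = W' x y by rewrite /W' !inord_val.
have VE x y : V x y = V' x y by rewrite /V' !inord_val.
have {}WC x y : W' x y = W' y x by exact: WC.
have {}VC x y : V' x y = V' y x by exact: VC.
under eq_bigr do rewrite WE VE.
rewrite !WE !VE sum_S4.
under eq_bigr do under eq_bigr do under eq_bigr do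
  rewrite !(odd_lift_perm, odd_perm1, lift_perm_id, lift_perm_lift, perm1).
rewrite !big_ord_recl !big_ord0 /= /bump /= !(addn0, add0n, add1n).
rewrite !(WC _ 0%N) (WC 2%N 1%N) !(WC 3%N _).
rewrite !(VC _ 0%N) (VC 2%N 1%N) !(VC 3%N _).
ring.
Qed.

Lemma perm4_ind (P : 'S_4 -> Prop) :
  (forall (i : 'I_4) (j : 'I_3) (k : 'I_2),
    P (lift_perm ord0 i (lift_perm ord0 j (lift_perm ord0 k 1%g)))) ->
  forall u, P u.
Proof.
move=> IH u.
have [f _ fK] := lift_perm0_bij 3; rewrite -(fK u); case: (f u) => i {}u /=.
have [{fK}f _ fK] := lift_perm0_bij 2; rewrite -(fK u); case: (f u) => j {}u /=.
have [{fK}f _ fK] := lift_perm0_bij 1; rewrite -(fK u); case: (f u) => k {}u /=.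
suff -> : u = 1%g by exact: IH.
by apply/permP => x; rewrite perm1 !ord1.
Qed.

(** * Labels of edges, and cancellation across faces *)

Lemma eq_set2 (T : finType) (x y z w : T) :
  ([set x; y] == [set z; w])%SET =
  (x == z) && (y == w) || (x == w) && (y == z).
Proof.
apply/eqP/idP => [eq_xyzw|]; last first.
  by case/orP => /andP[/eqP-> /eqP->] //; rewrite finset.setUC.
have := finset.set21 x y; rewrite eq_xyzw !inE.
have := finset.set22 x y; rewrite eq_xyzw !inE.
have := finset.set21 z w; rewrite -eq_xyzw !inE.
have := finset.set22 z w; rewrite -eq_xyzw !inE.
rewrite ![z == _]eq_sym ![w == _]eq_sym.
by do 4 (case: eqP => //= _).
Qed.

(** The complement of the edge from 0 to [lift ord0 m], written as a pair so that [eq_set2]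
    applies. *)
Definition opposite_edge (m : 'I_3) : {set 'I_4} :=
  [set if m == ord0 then o2 else o1; if m == ord_max then o2 else o3]%SET.

(** The even permutations preserving one pair of opposite edges form the Klein four-group, which
    preserves every such pair. The proof checks all cases. *)
Lemma even_quad_perm (u : 'S_4) (m : 'I_3) : ~~ odd_perm u ->
  ([set u o0; u o1] == [set o0; o1])%SET ||
    ([set u o0; u o1] == [set o2; o3])%SET ->
  ([set u o0; u (lift ord0 m)] == [set o0; lift ord0 m])%SET ||
  ([set u o0; u (lift ord0 m)] == opposite_edge m)%SET.
Proof.
rewrite /opposite_edge !eq_set2.
elim/perm4_ind: u => i j k.
rewrite !(odd_lift_perm, odd_perm1, lift_perm_id, lift_perm_lift).
case: (unliftP ord0 m) => [{}m|] ->; last first.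
  rewrite !(lift_perm_id, lift_perm_lift, perm1).
  case: i => -[|[|[|[|//]]]] ?; case: j => -[|[|[|//]]] ?;
    by case: k => -[|[|//]] ?; vm_compute.
case: (unliftP ord0 m) => [{}m|] ->.
  rewrite !(lift_perm_id, lift_perm_lift, perm1) [m]ord1.
  case: i => -[|[|[|[|//]]]] ?; case: j => -[|[|[|//]]] ?;
    by case: k => -[|[|//]] ?; vm_compute.
rewrite !(lift_perm_id, lift_perm_lift, perm1).
case: i => -[|[|[|[|//]]]] ?; case: j => -[|[|[|//]]] ?;
  by case: k => -[|[|//]] ?; vm_compute.
Qed.

(** Two even permutations sending the edge 01 into [Q] differ by an element of the Klein four-group,
    so a single [s] determines all the labels. *)
Lemma labelledE (Q : {set {set 'I_4}}) (s : 'S_4) (m : 'I_3) a :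
  is_quad_type Q -> ~~ odd_perm s -> [set s o0; s o1]%SET \in Q ->
  labelled Q m a =
    (a == s @: [set o0; lift ord0 m]) || (a == s @: opposite_edge m).
Proof.
move=> Q_quad s_even sQ.
have sI := @perm_inj _ s.
have s_set2 x y : ([set s x; s y] = s @: [set x; y])%SET.
  by rewrite imsetU1 imset_set1.
have sC : (~: (s @: [set o0; o1]) = s @: [set o2; o3])%SET.
  apply/setP => y; rewrite -(permKV s y) inE !mem_imset // !inE.
  by case: (_ y) => -[|[|[|[|//]]]].
have QE (B : {set 'I_4}) : ((s @: B)%SET \in Q) =
    (B == [set o0; o1]%SET) || (B == [set o2; o3]%SET).
  have -> : Q = [set (s @: [set o0; o1])%SET; (s @: [set o2; o3])%SET]%SET.
    case: Q_quad => c [_ Qc]; move: sQ; rewrite s_set2 Qc !inE => /orP[]/eqP Ec.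
      by rewrite -Ec sC.
    by rewrite -sC Ec finset.setCK finset.setUC.
  by rewrite !inE !(inj_eq (imset_inj sI)).
apply/existsP/idP => [[s' /and3P[s'_even]]|].
  have -> : s' = (s' * s^-1 * s)%g by rewrite mulgKV.
  have : ~~ odd_perm (s' * s^-1)%g.
    by rewrite odd_permM odd_permV (negbTE s_even) addbF.
  move: (_ * _)%g => u u_even; rewrite !permM !s_set2 QE => uQ /eqP ->.
  by rewrite !(inj_eq (imset_inj sI)) even_quad_perm.
case/orP => /eqP ->.
  by exists s; rewrite s_even sQ s_set2 /=.
(* An element of the Klein four-group exchanging the edge from 0 to [lift ord0 m] with its
   opposite. *)
pose u : 'S_4 := if m == 0 then (tperm o0 o2 * tperm o1 o3)%g
  else (tperm o0 o1 * tperm o2 o3)%g.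
exists (u * s)%g; rewrite !permM !s_set2 QE !(inj_eq (imset_inj sI)).
have -> /= : ~~ odd_perm (u * s)%g.
  rewrite odd_permM (negbTE s_even) /u.
  by case: ifP; rewrite odd_permM !odd_tperm.
rewrite /u /opposite_edge {u}; case: (unliftP ord0 m) => [{}m|] -> /=.
  rewrite !permM.
  case: (unliftP ord0 m) => [{}m|] -> /=; rewrite ?[m]ord1 !permE /= !eq_set2.
    by vm_compute.
  by vm_compute.
by rewrite !permM !permE /= !eq_set2; vm_compute.
Qed.

Lemma even_perm_of_quad (Q : {set {set 'I_4}}) : is_quad_type Q ->
  exists2 s : 'S_4, ~~ odd_perm s & [set s o0; s o1]%SET \in Q.
Proof.
case=> c [c2 ->]; have [x [y [neq_xy ->]]] := cards2P _ (introT eqP c2).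
have [s [s0 s1]] : exists s : 'S_4, s o0 = x /\ s o1 = y.
  exists (tperm o1 (tperm o0 x y) * tperm o0 x)%g.
  have y'_neq0 : tperm o0 x y != o0.
    by apply/eqP => y'0; rewrite -(tpermK o0 x y) y'0 tpermL eqxx in neq_xy.
  by rewrite !permM tpermL tpermK (tpermD _ y'_neq0) // tpermL.
have [s_odd|s_even] := boolP (odd_perm s); last first.
  by exists s; rewrite // s0 s1 !inE eqxx.
(* Exchanging 2 and 3 first corrects the parity and keeps the values at 0 and 1. *)
exists (tperm o2 o3 * s)%g; first by rewrite odd_permM odd_tperm s_odd.
by rewrite !permM !tpermD // s0 s1 !inE eqxx.
Qed.

(** An even [s] adapted to [Q] transports the labels to the standard ones. Reindexing the
    alternating sum by [s] keeps the signs, so [Q] disappears from the right-hand side. *)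
Lemma labelled_form (K : comRingType) (Q : {set {set 'I_4}})
    (w v : {set 'I_4} -> K) : is_quad_type Q ->
  let g (m : nat) (f : {set 'I_4} -> K) :=
    \sum_(a : {set 'I_4} | labelled Q (inord m) a) f a in
  (g 0%N w - g 1%N w) * (g 2%N v - g 1%N v)
    - (g 2%N w - g 1%N w) * (g 0%N v - g 1%N v) =
  - \sum_(u : 'S_4) (-1) ^+ odd_perm u *
      (w [set u o0; u o1]%SET * v [set u o0; u o2]%SET).
Proof.
move=> Q_quad g; have [s s_even sQ] := even_perm_of_quad Q_quad.
have E0 : inord 0 = ord0 :> 'I_3 by apply: val_inj; rewrite /= inordK.
have E1 : inord 1 = lift ord0 ord0 :> 'I_3 by apply: val_inj; rewrite /= inordK.
have E2 : inord 2 = lift ord0 (lift ord0 ord0) :> 'I_3.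
  by apply: val_inj; rewrite /= inordK.
have gE m f : g m f = f (s @: [set o0; lift ord0 (inord m)])%SET
                      + f (s @: opposite_edge (inord m))%SET.
  rewrite /g (eq_bigl _ _ (fun a => labelledE _ _ Q_quad s_even sQ)).
  rewrite (bigD1 (s @: [set o0; lift ord0 (inord m)])%SET) ?eqxx //=.
  rewrite (bigD1 (s @: opposite_edge (inord m))%SET) ?eqxx ?orbT //=.
    rewrite big1 ?addr0 // => a; case: eqP => //= _; case: eqP => //.
  rewrite (inj_eq (imset_inj (@perm_inj _ s))).
  rewrite /opposite_edge eq_set2.
  by case: (inord m : 'I_3) => -[|[|[|//]]] ?; vm_compute.
rewrite !gE E0 E1 E2 /opposite_edge /=.
have C (f : {set 'I_4} -> K) (x y : 'I_4) :
    f (s @: [set x; y])%SET = f (s @: [set y; x])%SET.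
  by rewrite finset.setUC.
have := alternating_sum_S4 (C w) (C v); rewrite /= => ->; congr (- _).
rewrite [RHS](reindex_inj (mulIg s)); apply: eq_bigr => u _.
by rewrite odd_permM (negbTE s_even) addbF !permM !imsetU1 !imset_set1.
Qed.

(** Crossing the face opposite to [u o3] is an involution [h] on pairs of a tetrahedron and a
    permutation. It reverses the sign of each term, so the sum equals its opposite, whence the
    assumption on 2. *)
Lemma sum_face_gluing_eq0 (K : fieldType) (N : nat) (D : triangulation 'I_N)
    (w v : 'I_N -> {set 'I_4} -> K) : 2 != 0 :> K ->
  (forall j (f : 'I_4) (a b : {set 'I_4}),
    #|a| = 2%N -> #|b| = 2%N -> f \notin a -> f \notin b ->
    w (nbr D j f) (Defs.glue D j f @: a)%SET *
      v (nbr D j f) (Defs.glue D j f @: b)%SET = w j a * v j b) ->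
  \sum_j \sum_(u : 'S_4) (-1) ^+ odd_perm u *
      (w j [set u o0; u o1]%SET * v j [set u o0; u o2]%SET) = 0.
Proof.
move=> nz2 wv_glue; rewrite pair_big /=; set S := \sum_p _.
pose h (p : 'I_N * 'S_4) :=
  (nbr D p.1 (p.2 o3), p.2 * Defs.glue D p.1 (p.2 o3))%g.
have hK : involutive h.
  by case=> j u; rewrite /h /= permM nbrK glueK mulgK.
suff S_opp : S = - S.
  apply/eqP; rewrite -(mulrI_eq0 _ (mulfI nz2)) mulr_natl mulr2n.
  by rewrite {1}S_opp addNr.
rewrite {1}/S (reindex_inj (inv_inj hK)) -sumrN; apply: eq_bigr => -[j u] _ /=.
have set2_glue x y (g : 'S_4) : ([set g x; g y] = g @: [set x; y])%SET.
  by rewrite imsetU1 imset_set1.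
rewrite odd_permM glue_odd addbT signrN !permM !set2_glue wv_glue ?mulNr //.
- by rewrite card_imset ?cards2 //; exact: perm_inj.
- by rewrite card_imset ?cards2 //; exact: perm_inj.
- by rewrite mem_imset ?inE //; exact: perm_inj.
- by rewrite mem_imset ?inE //; exact: perm_inj.
Qed.

(** * Barycenters of faces and classes of edges *)

Lemma set_val_inj (U : Type) (A : set U) (x y : A) :
  set_val x = set_val y -> x = y.
Proof. by rewrite set_valE => /val_inj. Qed.

Section Barycenter.
Variable R : realType.

(** Vertices are removed from the ideal simplex, so a set of fewer than two vertices has no
    barycenter there; the whole tetrahedron serves as default. *)
Definition face_of (a : {set 'I_4}) : {set 'I_4} :=
  if (1 < #|a|)%N then a else [set: 'I_4]%SET.

Lemma card_face_of a : (1 < #|face_of a|)%N.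
Proof. by rewrite /face_of; case: ifP => // _; rewrite cardsT card_ord. Qed.

Definition barycenter_row (a : {set 'I_4}) : 'rV[R]_4 :=
  \row_i (if i \in face_of a then #|face_of a|%:R^-1 else 0).

Lemma barycenter_subproof a : ideal_simplex R (barycenter_row a).
Proof.
rewrite /barycenter_row; move: (face_of a) (card_face_of a) => b b1.
have b0 : #|b|%:R != 0 :> R by rewrite pnatr_eq0; case: #|b| b1.
split=> [i||i]; rewrite ?mxE.
- by case: ifP; rewrite ?invr_ge0.
- under eq_bigr do rewrite mxE.
  by rewrite -big_mkcond /= sumr_const -[LHS]mulr_natr mulVf.
- case: ifP => // _; rewrite invf_lt1 ?ltr1n // ltr0n.
  exact: leq_trans b1.
Qed.

Definition barycenter (a : {set 'I_4}) : ideal_simplex R :=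
  SigSub (mem_set (barycenter_subproof a)).

Lemma barycenterE (a : {set 'I_4}) i : (1 < #|a|)%N ->
  set_val (barycenter a) 0 i = if i \in a then #|a|%:R^-1 else 0.
Proof. by move=> a1; rewrite set_valE /= mxE /face_of a1. Qed.

Lemma barycenter_eq0 (a : {set 'I_4}) i : (1 < #|a|)%N ->
  (set_val (barycenter a) 0 i == 0) = (i \notin a).
Proof.
move=> a1; rewrite barycenterE //; case: ifP => _; rewrite ?eqxx //.
by rewrite invr_eq0 pnatr_eq0; case: #|a| a1.
Qed.

Lemma barycenter_inj (a b : {set 'I_4}) : (1 < #|a|)%N -> (1 < #|b|)%N ->
  barycenter a = barycenter b -> a = b.
Proof.
move=> a1 b1 eq_ab; apply/setP => i; apply: negb_inj.
by rewrite -!barycenter_eq0 // eq_ab.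
Qed.

Lemma barycenter_perm (x : ideal_simplex R) (a : {set 'I_4}) (g : 'S_4) :
  (1 < #|a|)%N ->
  (forall i, set_val x 0 (g i) = set_val (barycenter a) 0 i) ->
  x = barycenter (g @: a)%SET.
Proof.
move=> a1 xE; apply: set_val_inj; apply/rowP => i.
rewrite -(permKV g i) xE !barycenterE ?card_imset ?mem_imset //;
  exact: perm_inj.
Qed.

Variables (T : Type) (D : triangulation T).

Lemma edge_step_sym u v : edge_step D u v -> edge_step D v u.
Proof.
case: u v => [t a] [t' b] [f [/= fNa -> ->]].
exists (Defs.glue D t f f) => /=; split; rewrite ?nbrK ?glueK //.
  by rewrite mem_imset //; exact: perm_inj.
rewrite -imset_comp -[LHS]imset_id; apply: eq_imset => i /=.
by rewrite permK.
Qed.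

Lemma glue_step_sym (u v : T * ideal_simplex R) :
  glue_step D u v -> glue_step D v u.
Proof.
case: u v => [t x] [t' y] [f [/= xf0 -> yE]].
exists (Defs.glue D t f f) => /=; split; rewrite ?yE ?nbrK ?glueK // => i.
by rewrite -yE permKV.
Qed.

(** The coordinates of the barycenter vanish exactly off [a], so it lies on the face opposite to [f]
    exactly when [f] is not in [a]. *)
Lemma glue_step_barycenter t (a : {set 'I_4}) v : (1 < #|a|)%N ->
  glue_step D (t, barycenter a) v ->
  exists b : {set 'I_4},
    [/\ v.2 = barycenter b, #|b| = #|a| & edge_step D (t, a) (v.1, b)].
Proof.
case: v => t' y a1 [f [/= /eqP af0 -> /(barycenter_perm a1) ->]].
exists (Defs.glue D t f @: a)%SET; split=> //.
  by rewrite card_imset //; exact: perm_inj.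
by exists f; split=> //=; rewrite -barycenter_eq0.
Qed.

Lemma edge_step_barycenter u v : edge_step D u v ->
  #|u.2| = #|v.2| /\
  ((1 < #|u.2|)%N -> glue_step D (u.1, barycenter u.2) (v.1, barycenter v.2)).
Proof.
case: u v => [t a] [t' b] [f [/= fNa -> ->]].
have card_ga : #|(Defs.glue D t f @: a)%SET| = #|a|.
  by rewrite card_imset //; exact: perm_inj.
split=> [//|a1]; exists f; split=> //= [|i].
  by apply/eqP; rewrite barycenter_eq0.
by rewrite !barycenterE ?card_ga // mem_imset //; exact: perm_inj.
Qed.

Lemma edge_class_barycenter u v :
  clos_refl_sym_trans _ (edge_step D) u v ->
  #|u.2| = #|v.2| /\
  ((1 < #|u.2|)%N -> clos_refl_sym_trans _ (@glue_step R T D)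
     (u.1, barycenter u.2) (v.1, barycenter v.2)).
Proof.
elim=> {u v} [u v|u|u v _ [card_uv IH]|u v w _ [card_uv IHuv] _ [card_vw IHvw]].
- by move=> /edge_step_barycenter[card_uv uv]; split=> // /uv; exact: rst_step.
- by split=> // _; exact: rst_refl.
- by split=> // v1; apply/rst_sym/IH; rewrite card_uv.
- split=> [|u1]; first by rewrite card_uv.
  by apply: rst_trans (IHuv u1) _; apply: IHvw; rewrite -card_uv.
Qed.

Lemma glue_class_barycenter p q :
  clos_refl_sym_trans _ (@glue_step R T D) p q ->
  forall a : {set 'I_4}, (1 < #|a|)%N -> p.2 = barycenter a ->
  exists b : {set 'I_4}, [/\ (1 < #|b|)%N, q.2 = barycenter b
    & clos_refl_sym_trans _ (edge_step D) (p.1, a) (q.1, b)].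
Proof.
pose P p1 p2 := forall a : {set 'I_4}, (1 < #|a|)%N -> p1.2 = barycenter a ->
  exists b : {set 'I_4}, [/\ (1 < #|b|)%N, p2.2 = barycenter b
    & clos_refl_sym_trans _ (edge_step D) (p1.1, a) (p2.1, b)].
have P_step u v : glue_step D u v -> P u v.
  case: u => t x uv a a1 /= Ex; rewrite {}Ex in uv.
  have [b [Eb card_b ab]] := glue_step_barycenter a1 uv.
  by exists b; rewrite card_b; split=> //; exact: rst_step.
have P_trans p1 p2 p3 : P p1 p2 -> P p2 p3 -> P p1 p3.
  move=> P12 P23 a a1 /(P12 _ a1)[b [b1 /(P23 _ b1)[c [c1 Ec bc]] ab]].
  by exists c; split=> //; apply: rst_trans bc.
(* The symmetry rule of the closure reverses [P], so both directions are proved together. *)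
move=> pq; suff [] : P p q /\ P q p by [].
elim: pq => {p q} [u v uv|u|u v _ []|u v w _ [Puv Pvu] _ [Pvw Pwv]] //.
- by split; apply: P_step => //; exact: glue_step_sym.
- by split=> a a1 Ea; exists a; split=> //; exact: rst_refl.
- by split; [apply: P_trans Puv Pvw | apply: P_trans Pwv Pvu].
Qed.

(** A step needs a vertex outside the set, so none starts or ends at the full set. This is why the
    barycenter of a tetrahedron determines it. *)
Lemma edge_class_full u v : clos_refl_sym_trans _ (edge_step D) u v ->
  (u.2 = [set: 'I_4]%SET \/ v.2 = [set: 'I_4]%SET) -> u = v.
Proof.
have step w z : edge_step D w z -> w.2 <> [set: 'I_4]%SET.
  by case=> f [+ _ _] wT; rewrite wT inE.
elim=> {u v} [u v uv|//|u v _ IH|u v w _ IHuv _ IHvw].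
- by case=> [/(step _ _ uv)|/(step _ _ (edge_step_sym uv))].
- by move=> uvT; apply/esym/IH; case: uvT; [right|left].
- case=> [uT|wT].
    by have uv := IHuv (or_introl uT); rewrite uv IHvw //; left; rewrite -uv.
  by have vw := IHvw (or_intror wT); rewrite IHuv //; right; rewrite vw.
Qed.

Variables (M : topologicalType) (Phi : T -> ideal_simplex R -> M).
Hypothesis Phi_tri : ideal_triangulation D Phi.

Lemma barycenter_edge_class t (a : {set 'I_4}) t' (b : {set 'I_4}) :
  (1 < #|a|)%N -> (1 < #|b|)%N ->
  Phi t (barycenter a) = Phi t' (barycenter b) <->
  clos_refl_sym_trans _ (edge_step D) (t, a) (t', b).
Proof.
move=> a1 b1; rewrite (Phi_glue Phi_tri); split.
  move=> /glue_class_barycenter/(_ a a1 erefl)[b' [b'1 /= Eb tab]].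
  by rewrite (barycenter_inj b1 b'1 Eb).
by move=> /edge_class_barycenter[_ /(_ a1)].
Qed.

Lemma barycenter_simplex_inj t t' :
  Phi t (barycenter [set: 'I_4]%SET) = Phi t' (barycenter [set: 'I_4]%SET) ->
  t = t'.
Proof.
rewrite barycenter_edge_class ?cardsT ?card_ord //.
by move=> /edge_class_full/(_ (or_introl erefl))[].
Qed.

End Barycenter.

(** * Integer iterates and incidence series *)

Lemma ziterD (X : Type) (f finv : X -> X) :
  cancel f finv -> cancel finv f -> forall (k l : int) x,
  ziter f finv (k + l) x = ziter f finv k (ziter f finv l x).
Proof.
move=> fK finvK.
have ziterS k x : ziter f finv (1 + k) x = f (ziter f finv k x).
  (* [Negz 0] is -1, the one negative integer whose successor is nonnegative. *)
  case: k => [n|[|n]]; first by rewrite -intS.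
    by rewrite NegzE addrN /= finvK.
  by rewrite NegzE intS opprD addNKr -NegzE /= finvK.
have ziterP k x : ziter f finv (-1 + k) x = finv (ziter f finv k x).
  by rewrite -[k in RHS](addKr (-1)) opprK ziterS fK.
elim/int_rec => [|n IH|n IH] l x; first by rewrite add0r.
  by rewrite -add1n PoszD -addrA !ziterS IH.
by rewrite -add1n PoszD opprD -addrA !ziterP IH.
Qed.

Local Open Scope classical_set_scope.
Local Open Scope ring_scope.

(** A sum with infinite support is 0 by default, hence the finiteness hypothesis; everything is
    restricted to the union [A] of the supports. *)
Lemma exchange_fsum (V : nmodType) (I : choiceType) (J : finType) (P : pred J)
    (F : I -> J -> V) :
  (forall j, P j -> finite_set [set i | F i j != 0]) ->
  \sum_(i \in [set: I]) \sum_(j | P j) F i j =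
  \sum_(j | P j) \sum_(i \in [set: I]) F i j.
Proof.
move=> F_fin; pose A := \bigcup_(j in [set j | P j]) [set i | F i j != 0].
have A_fin : finite_set A by apply: bigcup_finite => // j; exact: F_fin.
have F0 i j : ~ A i -> P j -> F i j = 0.
  move=> NAi Pj; apply/eqP/negP => Fij; apply: NAi.
  by exists j => //; exact/negP.
have AT f : (forall i, ~ A i -> f i = 0) ->
    \sum_(i \in [set: I]) f i =
    \sum_(i <- finmap.enum_fset (fset_set A)) f i :> V.
  move=> f0; rewrite -fsbig_finite //; apply/esym/fsbig_widen => // i [_].
  exact: f0.
rewrite AT => [|i NAi]; last by rewrite big1 // => j; exact: F0.
rewrite exchange_big /=; apply: eq_bigr => j Pj.
by rewrite AT // => i NAi; exact: F0.
Qed.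

Lemma card_labelled Q m a : labelled Q m a -> #|a| = 2%N.
Proof.
by case/existsP => s /and3P[_ _ /eqP->]; rewrite cards2 (inj_eq perm_inj).
Qed.

Section Incidence.
Variables (N : nat) (D : triangulation 'I_N).
Variables (Tt : Type) (act : int -> Tt -> Tt).
Variables (et : 'I_N -> set (Tt * {set 'I_4})) (Deltat : 'I_N -> Tt).

(** This is w(j, a), and v(j, a) when taken at 1/x. For an edge [a], [incidence_uniq] leaves at most
    one nonzero term. *)
Definition incidence_series (K : fieldType) (x : K) (i j : 'I_N) a : K :=
  \sum_(k \in [set: int]) `[< et i (act k (Deltat j), a) >]%:R * x ^ k.

Hypothesis incidence_uniq : forall i j (a : {set 'I_4}) k l, #|a| = 2%N ->
  et i (act k (Deltat j), a) -> et i (act l (Deltat j), a) -> k = l.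

Lemma twisted_gluingE Q (K : fieldType) m (x : K) i j :
  twisted_gluing Q act et Deltat m x i j =
  \sum_(a : {set 'I_4} | labelled (Q j) m a) incidence_series x i j a.
Proof.
rewrite mxE /incidence_series -exchange_fsum; last first.
  move=> a /card_labelled a2.
  have [[k ak]|Na] := pselect (exists k, et i (act k (Deltat j), a)).
    apply: (sub_finite_set _ (finite_set1 k)) => l /=.
    case: asboolP; rewrite ?mul0r ?eqxx // => al _.
    exact: incidence_uniq al ak.
  apply: (sub_finite_set _ (finite_set0 _)) => l /=.
  by case: asboolP => [al|_]; [case: Na; exists l | rewrite mul0r eqxx].
apply: eq_fsbigr => k _; rewrite mxE -mulr_suml; congr (_ * _).
(* The matrix entry is a [Posz], whose image in [K] is by computation that of a natural number. *)
rewrite -[LHS]/(_%:R) -sum1_card natr_sum.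
rewrite [RHS](eq_bigr
  (fun a => if `[< et i (act k (Deltat j), a) >] then 1 else 0)).
  by rewrite -big_mkcondr; apply: eq_bigl => a; rewrite inE.
by move=> a _; case: `[< _ >].
Qed.

Lemma NZ_AE Q (K : fieldType) (x : K) i j :
  NZ_A Q act et Deltat x i j =
  \sum_(a : {set 'I_4} | labelled (Q j) (inord 0) a) incidence_series x i j a -
  \sum_(a : {set 'I_4} | labelled (Q j) (inord 1) a) incidence_series x i j a.
Proof. by rewrite /NZ_A [LHS]mxE [X in _ + X]mxE !twisted_gluingE. Qed.

Lemma NZ_BE Q (K : fieldType) (x : K) i j :
  NZ_B Q act et Deltat x i j =
  \sum_(a : {set 'I_4} | labelled (Q j) (inord 2) a) incidence_series x i j a -
  \sum_(a : {set 'I_4} | labelled (Q j) (inord 1) a) incidence_series x i j a.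
Proof. by rewrite /NZ_B [LHS]mxE [X in _ + X]mxE !twisted_gluingE. Qed.

Lemma incidence_series_shift (K : fieldType) (x : K) i j j' a b (l : int) :
  x != 0 ->
  (forall k,
    et i (act (k + l) (Deltat j'), b) <-> et i (act k (Deltat j), a)) ->
  incidence_series x i j' b = x ^ l * incidence_series x i j a.
Proof.
move=> x0 ab; rewrite /incidence_series mulr_fsumr.
rewrite (reindex_fsbigT (fun k => k + l)); last first.
  by exists (fun k => k - l) => k; rewrite ?addrK ?subrK.
apply: eq_fsbigr => k _; rewrite expfzDr // (asbool_equiv_eq (ab k)).
by rewrite mulrA mulrC.
Qed.

(** The shift [l] depends only on the face, not on [i] or [a]; hence the factors of w and v across a
    face are inverse to each other. *)
Hypothesis incidence_glue : forall (j : 'I_N) (f : 'I_4),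
  exists l : int, forall i k (a : {set 'I_4}), #|a| = 2%N -> f \notin a ->
    et i (act (k + l) (Deltat (nbr D j f)), Defs.glue D j f @: a)%SET <->
    et i (act k (Deltat j), a).

Lemma NZ_symplectic Q (K : fieldType) (x : K) :
  (forall j, is_quad_type (Q j)) -> 2 != 0 :> K -> x != 0 ->
  NZ_A Q act et Deltat x *m (NZ_B Q act et Deltat x^-1)^T =
  NZ_B Q act et Deltat x *m (NZ_A Q act et Deltat x^-1)^T.
Proof.
move=> Q_quad nz2 x0.
(* The four matrices are generalized, keeping only their entry formulas, so that [mxE] does not
   unfold them. *)
move: (NZ_AE Q x) (NZ_BE Q x) (NZ_AE Q x^-1) (NZ_BE Q x^-1).
move: (NZ_A _ _ _ _ x) (NZ_B _ _ _ _ x).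
move: (NZ_A _ _ _ _ x^-1) (NZ_B _ _ _ _ x^-1).
move=> A' B' A B AE BE A'E B'E; apply/matrixP => i i'.
have S0 : \sum_j \sum_(u : 'S_4) (-1) ^+ odd_perm u *
    (incidence_series x i j [set u o0; u o1]%SET *
     incidence_series x^-1 i' j [set u o0; u o2]%SET) = 0.
  apply: (sum_face_gluing_eq0 (D := D)) => // j f a b a2 b2 fNa fNb.
  have [l shift] := incidence_glue j f.
  have shiftE (y : K) i0 (d : {set 'I_4}) :
      #|d| = 2%N -> f \notin d -> y != 0 ->
      incidence_series y i0 (nbr D j f) (Defs.glue D j f @: d)%SET
      = y ^ l * incidence_series y i0 j d.
    by move=> d2 fNd ?; apply: incidence_series_shift => // k; exact: shift.
  by rewrite !shiftE ?invr_eq0 // mulrACA -expfzMl divff // exp1rz mul1r.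
rewrite !mxE; apply/eqP; rewrite -subr_eq0 -sumrB -oppr_eq0 -sumrN.
apply/eqP; rewrite -[RHS]S0; apply: eq_bigr => j _.
rewrite -[RHS]opprK -(labelled_form _ _ (Q_quad j)); congr (- _).
by rewrite !mxE AE BE A'E B'E.
Qed.

End Incidence.

(** * The deck group acting on tetrahedra, and the theorem *)

Lemma lift_act (R : realType) (N : nat) (M Mt : topologicalType)
    (D : triangulation 'I_N) (Phi : 'I_N -> ideal_simplex R -> M)
    (p : Mt -> M) (xt : Mt) (mu : R -> M) (tau tauinv : Mt -> Mt)
    (htau : deck_generator p xt mu tau tauinv)
    (Tt : Type) (Dt : triangulation Tt)
    (Phit : Tt -> ideal_simplex R -> Mt) (proj : Tt -> 'I_N)
    (hlift : lifted_triangulation D Dt Phi Phit p proj)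
    (act : int -> Tt -> Tt)
    (hact : forall k t x, Phit (act k t) x = ziter tau tauinv k (Phit t x))
    (t t' : Tt) : proj t = proj t' -> exists k, t' = act k t.
Proof.
(* The barycenters of two lifts of a tetrahedron lie in one fibre, which is an orbit of [tau]. *)
move=> tt'; pose b : ideal_simplex R := barycenter R [set: 'I_4]%SET.
have : p (Phit t b) = p (Phit t' b) by rewrite !(lift_Phi hlift) tt'.
move=> /(deck_fibre htau)[k]; rewrite -hact => t'E; exists k.
by apply: (barycenter_simplex_inj (lift_realized hlift)); exact: t'E.
Qed.

Unset Implicit Arguments.
Set Strict Implicit.

Theorem theorem1p2 (R : realType)
  (* the one-cusped hyperbolic 3-manifold M *)
  (M : topologicalType) (hM : hyperbolic_3manifold R M)
  (c : H3 R -> M) (hc : torus_cusp c)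
  (* its ideal triangulation, with edges e *)
  (N : nat) (D : triangulation 'I_N)
  (Phi : 'I_N -> ideal_simplex R -> M) (hPhi : ideal_triangulation D Phi)
  (e : 'I_N -> set ('I_N * {set 'I_4})) (he : edge_enumeration D e)
  (* the peripheral curve mu and the epimorphism alpha *)
  (mu : R -> M) (hmu : peripheral_curve c mu)
  (alpha : (R -> M) -> int) (halpha : pi1_epimorphism (mu 0) alpha)
  (halphamu : alpha mu = 1)
  (* the cover of M given by the kernel of alpha *)
  (Mt : topologicalType) (p : Mt -> M) (xt : Mt) (hxt : p xt = mu 0)
  (hp : kernel_cover alpha p xt)
  (tau tauinv : Mt -> Mt) (htau : deck_generator p xt mu tau tauinv)
  (* the lifted triangulation and the action of mu on it *)
  (Tt : Type) (Dt : triangulation Tt)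
  (Phit : Tt -> ideal_simplex R -> Mt) (proj : Tt -> 'I_N)
  (hlift : lifted_triangulation D Dt Phi Phit p proj)
  (act : int -> Tt -> Tt)
  (hact : forall k t x, Phit (act k t) x = ziter tau tauinv k (Phit t x))
  (* the choices of lifts and of quad types *)
  (et : 'I_N -> set (Tt * {set 'I_4})) (het : forall i, is_edge Dt (et i))
  (hete : forall i u, et i u -> e i (proj u.1, u.2))
  (Deltat : 'I_N -> Tt) (hDeltat : forall j, proj (Deltat j) = j)
  (Q : 'I_N -> {set {set 'I_4}}) (hQ : forall j, is_quad_type (Q j)) :
  NZ_A Q act et Deltat indet *m (NZ_B Q act et Deltat indet^-1)^T =
  NZ_B Q act et Deltat indet *m (NZ_A Q act et Deltat indet^-1)^T.
Proof.
have tauD := ziterD (deck_K htau) (deck_inv_K htau).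
have hPhit := lift_realized hlift.
(* [P] is the image of the midpoint of any edge representing the class [et i]. *)
have etE i : exists P, forall k j (a : {set 'I_4}), #|a| = 2%N ->
    et i (act k (Deltat j), a) <->
    P = ziter tau tauinv k (Phit (Deltat j) (barycenter R a)).
  have [t [b [b2 ->]]] := het i; exists (Phit t (barycenter R b)) => k j a a2.
  by rewrite -hact (barycenter_edge_class hPhit) ?b2 ?a2.
have et_uniq i j (a : {set 'I_4}) k l : #|a| = 2%N ->
    et i (act k (Deltat j), a) -> et i (act l (Deltat j), a) -> k = l.
  move=> a2; have [P PE] := etE i; rewrite !PE // => -> Ekl.
  apply/eqP; rewrite -subr_eq0; apply/eqP.
  apply: (deck_free htau (x := Phit (Deltat j) (barycenter R a))).
  by rewrite addrC tauD Ekl -tauD addNr.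
have glue_shift j (f : 'I_4) : exists l : int, forall i k (a : {set 'I_4}),
    #|a| = 2%N -> f \notin a ->
    et i (act (k + l) (Deltat (nbr D j f)), Defs.glue D j f @: a)%SET <->
    et i (act k (Deltat j), a).
  (* The neighbour of the chosen lift and the chosen lift of the neighbour cover the same
     tetrahedron; [l] is the translation between them. *)
  have : proj (nbr Dt (Deltat j) f) = proj (Deltat (nbr D j f)).
    by rewrite (lift_nbr hlift) !hDeltat.
  move=> /esym/(lift_act htau hlift hact)[l nbrE]; exists l => i k a a2 fNa.
  have ga2 : #|(Defs.glue D j f @: a)%SET| = 2%N.
    by rewrite card_imset //; exact: perm_inj.
  have [P PE] := etE i; rewrite !PE // tauD -hact -nbrE.
  suff -> : Phit (Deltat j) (barycenter R a) =
    Phit (nbr Dt (Deltat j) f) (barycenter R (Defs.glue D j f @: a)%SET) by [].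
  apply/(barycenter_edge_class hPhit); rewrite ?a2 ?ga2 //.
  by apply: rst_step; exists f; rewrite (lift_glue hlift) hDeltat.
apply: NZ_symplectic et_uniq glue_shift _ _ _ hQ _ _.
  rewrite -(rmorph_nat (@tofrac {poly int})) tofrac_eq0.
  by rewrite -polyC_natr polyC_eq0.
by rewrite tofrac_eq0 polyX_eq0.
Qed.
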